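(* For every $n\ge 2$, $s_n^k(123,231)=0$ for all $3\le k\le n$; $$s_n^2(123,231)=\begin{cases}\frac{n(n-6)}{24}+\frac n2 & \text{if } n\equiv 0 \pmod 6,\\[4pt] \frac{(n-1)(n+1)}{24} & \text{if } n\equiv 1,5 \pmod 6,\\[4pt] \frac{(n-4)(n-2)}{24}+\frac n2 & \text{if } n\equiv 2,4 \pmod 6,\\[4pt] \frac{(n-3)(n+3)}{24} & \text{if } n\equiv 3 \pmod 6;\end{cases}$$ $$s_n^1(123,231)=\begin{cases}\frac{n(n-6)}{12}+6\binom{\frac{n+6}{6}}{2} & \text{if } n\equiv 0 \pmod 6,\\[4pt] \frac{(n-3)(n-1)}{8}+\frac{(n-7)(n-1)}{12}+6\binom{\frac{n+5}{6}}{2}+\frac{n+2}{3} & \text{if } n\equiv 1 \pmod 6,\\[4pt] \frac{n(n-2)}{12}+6\binom{\frac{n+4}{6}}{2} & \text{if } n\equiv 2 \pmod 6,\\[4pt] \frac{(n-3)(n-1)}{8}+\frac{(n-5)(n-3)}{12}+6\binom{\frac{n+3}{6}}{2}+\frac{2n+3}{3} & \text{if } n\equiv 3 \pmod 6,\\[4pt] \frac{(n-12)(n+2)}{12}+6\binom{\frac{n+8}{6}}{2} & \text{if } n\equiv 4 \pmod 6,\\[4pt] \frac{(n-3)(n-1)}{8}+\frac{(n-5)(n-3)}{12}+6\binom{\frac{n+1}{6}}{2}+n & \text{if } n\equiv 5 \pmod 6;\end{cases}$$ and $s_n^0(123,231)=\binom n2+1-s_n^1(123,231)-s_n^2(123,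231)$.
   Context: $S_n$ denotes the set of permutations of $\{1,\dots,n\}$ written in one-line notation $\pi=\pi_1\pi_2\cdots\pi_n$. For $\alpha\in S_m$, $\pi\in S_n$ contains the pattern $\alpha$ if there are indices $i_1<i_2<\dots<i_m$ such that $\pi_{i_1}\pi_{i_2}\cdots\pi_{i_m}$ is order-isomorphic to $\alpha$; otherwise $\pi$ avoids $\alpha$. For a set $T$ of patterns, $S_n^k(T)$ is the set of $\pi\in S_n$ that have exactly $k$ fixed points (indices $i$ with $\pi_i=i$) and avoid every pattern in $T$; $s_n^k(T)=|S_n^k(T)|$. The braces around $T$ are omitted, e.g. $s_n^k(123,231)=s_n^k(\{123,231\})$. *)

(* Defs.v *)
From HB Require Import structures.
From mathcomp Require Import all_boot all_order all_algebra all_fingroup.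

Set Implicit Arguments.
Unset Strict Implicit.
Unset Printing Implicit Defensive.

(* Indices and values are 0-based: [pi : 'S_n] sends [i] to [pi_(i+1) - 1].
   Fixed points and pattern containment do not depend on this shift. *)
Definition oneline n (pi : 'S_n) : seq nat := [seq (pi i).+1 | i <- enum 'I_n].

Definition contains n (pi : 'S_n) m (alpha : 'S_m) : bool :=
  [exists f : {ffun 'I_m -> 'I_n},
     [forall a : 'I_m, forall b : 'I_m, (a < b) ==> (f a < f b)] &&
     [forall a : 'I_m, forall b : 'I_m,
        (pi (f a) < pi (f b)) == (alpha a < alpha b)]].

Definition avoids n (pi : 'S_n) m (alpha : 'S_m) : bool := ~~ contains pi alpha.

(* A set of patterns may mix lengths, hence the dependent pairs. *)
Definition pattern : Type := {m : nat & 'S_m}.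

Definition mkpattern m (alpha : 'S_m) : pattern := existT (fun m => 'S_m) m alpha.

Definition fixed_points n (pi : 'S_n) : {set 'I_n} := [set i | pi i == i].

Definition avoidance_class n k (T : seq pattern) : {set 'S_n} :=
  [set pi : 'S_n | (#|fixed_points pi| == k) &&
                   all (fun alpha : pattern => avoids pi (projT2 alpha)) T].

Definition s_count n k (T : seq pattern) : nat := #|avoidance_class n k T|.

Definition perm123 : 'S_3 := 1%g.
(* [ordS] is the cyclic successor. *)
Definition perm231 : 'S_3 := perm (@ordS_inj 3).

Definition T123_231 : seq pattern := [:: mkpattern perm123; mkpattern perm231].

Lemma oneline_perm123 : oneline perm123 = [:: 1; 2; 3].
Proof. by rewrite /oneline enum_ordSl enum_ordSl enum_ordSl enum_ord0 /= !perm1. Qed.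

Lemma oneline_perm231 : oneline perm231 = [:: 2; 3; 1].
Proof. by rewrite /oneline enum_ordSl enum_ordSl enum_ordSl enum_ord0 /= !permE. Qed.

(* Main.v *)
Require Import Defs.
From HB Require Import structures.
From mathcomp Require Import all_boot all_order all_algebra all_fingroup.
From mathcomp Require Import zify ring lra.

(** When a permutation avoiding 123 and 231 has an ascent pair (two positions, not
    necessarily adjacent, with increasing values), every later value lies strictly
    between the two values of the pair: otherwise a 123 or a 231 appears. This
    confinement ([avoids_confining]) forces the shape of the permutation: either
    it is decreasing, or its one-line notation consists of three consecutive
    decreasing blocks, the first with the [a] largest values, the second with the
    [b > 0] smallest and the third with the remaining [c > 0] values
    ([confining_block]). The sizes determine the permutation, so there are
    ['C(n, 2) + 1] such permutations.

    Each block has slope -1 and meets the diagonal at most once. In positions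
    numbered from 0, the first block does so when [n] is odd and [n < 2 a], the
    second when [a + b] is odd and [a < b], and the third when [n + b] is odd and
    [2 a + b < n] ([card_fixed_block]). The first condition excludes the other
    two, so there are at most two fixed points, and the numbers of permutations
    with 0, 1 and 2 fixed points are numbers of lattice points [(a, b)].

    - Two fixed points: for fixed [a] of the parity of [n] there are
      [(n - 3 a) / 2] choices of [b]; this sum over [a] depends on [n] modulo 6
      ([s_count2], [double_two_fixed_sum]).
    - One fixed point: the second and the third conditions each have
      [h (h + 1) / 2] solutions with [h = floor (n / 2)] and [b > 0], and for odd
      [n] the first one has [h (h - 1) / 2] solutions and the decreasing
      permutation contributes one more fixed point; subtracting the permutations
      with two fixed points twice gives the count ([s_count1]).
    - No fixed point: the rest ([s_count012]). *)

Set Implicit Arguments.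
Unset Strict Implicit.
Unset Printing Implicit Defensive.

(** * Counting an interval *)

Lemma sum_interval N lo hi :
  \sum_(i < N) (lo <= i < hi : nat) = minn hi N - lo.
Proof.
elim: N => [|N IH]; first by rewrite big_ord0; lia.
by rewrite big_ord_recr /= IH; lia.
Qed.

Lemma sum_interval_parity N lo hi :
  \sum_(i < N) ((lo <= i < hi) && (odd i == odd lo) : nat)
  = uphalf (minn hi N - lo).
Proof.
elim: N => [|N IH]; first by rewrite big_ord0; lia.
by rewrite big_ord_recr /= IH; lia.
Qed.

(** Each block of positions is decreasing with slope -1, so it meets the diagonal
    where twice the position equals a constant [m]: at most once. *)
Lemma sum_interval_double N lo hi m :
  \sum_(i < N) ((lo <= i < hi) && (i.*2 == m) : nat)
  = (lo.*2 <= m < (minn hi N).*2) && ~~ odd m :> nat.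
Proof.
elim: N => [|N IH]; first by rewrite big_ord0; lia.
by rewrite big_ord_recr /= IH; lia.
Qed.

(** * Three-block permutations *)

Lemma perm_val_rank n (pi : 'S_n) i :
  \sum_(k < n) (pi k < pi i : nat) = pi i.
Proof.
rewrite (reindex_inj (@perm_inj _ (pi^-1)%g)) /=.
under eq_bigr => k _ do rewrite permKV.
by rewrite (sum_interval n 0 (pi i)); have := ltn_ord (pi i); lia.
Qed.

Lemma perm_val_neq n (pi : 'S_n) (x y : 'I_n) : x < y -> pi x != pi y :> nat.
Proof.
by rewrite (inj_eq val_inj) (inj_eq perm_inj) -(inj_eq val_inj) /=; lia.
Qed.

(** A value is the number of smaller values, so a permutation is determined by
    the set of its inversions. *)
Lemma perm_order_inj n (pi sigma : 'S_n) :
    (forall i k : 'I_n, i < k -> (pi i < pi k) = (sigma i < sigma k)) ->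
  pi = sigma.
Proof.
move=> same; apply/permP=> i; apply: ord_inj.
rewrite -perm_val_rank -[RHS]perm_val_rank; apply: eq_bigr => k _.
case: (ltngtP k i) => [lt_ki|lt_ik|/val_inj ->] //=; last by rewrite !ltnn.
- by rewrite same.
- have := same _ _ lt_ik; have := perm_val_neq pi lt_ik.
  by have := perm_val_neq sigma lt_ik; lia.
Qed.

(** With [c = n - a - b]: the [a] largest values, then the [b] smallest ones, then
    the [c] middle ones, each group in decreasing order. *)
Definition block n a b i :=
  if i < a then n.-1 - i
  else if i < a + b then (a + b).-1 - i
  else n.-1 + b - i.

Lemma block_bound n a b i : a + b <= n -> i < n -> block n a b i < n.
Proof. by rewrite /block; do ! case: ifP => ?; lia. Qed.

Lemma block_ascent n a b i k : a + b <= n -> i < k < n ->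
  (block n a b i < block n a b k) = ((a <= i < a + b) && (a + b <= k)).
Proof. by rewrite /block; do ! case: ifP => ?; lia. Qed.

Lemma block_inj n a b i k : a + b <= n -> i < n -> k < n ->
  block n a b i = block n a b k -> i = k.
Proof. by rewrite /block; do ! case: ifP => ?; lia. Qed.

(** The injectivity of [block] needs [a + b <= n]; the default identity makes
    this a total function of the two sizes. *)
Definition block_perm n a b : 'S_n :=
  insubd (perm_one 'I_n) [ffun i : 'I_n => insubd i (block n a b i)].

Lemma block_permE n a b (i : 'I_n) : a + b <= n ->
  block_perm n a b i = block n a b i :> nat.
Proof.
move=> le_ab_n.
have valE (j : 'I_n) : insubd j (block n a b j) = block n a b j :> nat.
  by rewrite val_insubd block_bound.
rewrite /block_perm -pvalE val_insubd.
case: injectiveP => [_|[]]; first by rewrite ffunE.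
move=> j k; rewrite !ffunE => /(congr1 val); rewrite /= !valE.
by move/block_inj => /(_ le_ab_n (ltn_ord j) (ltn_ord k)) /val_inj.
Qed.

(** The three summands say whether the first, second and third block meets the
    diagonal: on them the value plus the position is constantly [n - 1],
    [a + b - 1] and [n - 1 + b]. *)
Definition block_fixed n a b : nat :=
  (odd n && (n < a.*2)) + (odd (a + b) && (a < b))
  + (odd (n + b) && (a.*2 + b < n)).

Lemma card_fixed_block n a b : 0 < n -> a + b <= n ->
  #|fixed_points (block_perm n a b)| = block_fixed n a b.
Proof.
move=> n_gt0 le_ab_n.
pose F1 (i : 'I_n) := (0 <= i < a) && (i.*2 == n.-1).
pose F2 (i : 'I_n) := (a <= i < a + b) && (i.*2 == (a + b).-1).
pose F3 (i : 'I_n) := (a + b <= i < n) && (i.*2 == n.-1 + b).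
have -> : #|fixed_points (block_perm n a b)|
          = \sum_(i < n) (F1 i + F2 i + F3 i).
  rewrite -sum1dep_card big_mkcond; apply: eq_bigr => i _.
  rewrite -(inj_eq val_inj) /= block_permE // /block /F1 /F2 /F3.
  have := ltn_ord i.
  by case: (ltnP i a) => ?; case: (ltnP i (a + b)) => ?; case: eqP; lia.
rewrite !big_split /= /F1 /F2 /F3 !sum_interval_double.
by rewrite /block_fixed; congr (_ + _ + _); congr nat_of_bool; lia.
Qed.

(** * Avoiding 123 and 231 *)

Lemma contains_perm123P n (pi : 'S_n) :
  reflect (exists i j k : 'I_n, [/\ i < j < k & pi i < pi j < pi k])
          (contains pi perm123).
Proof.
apply: (iffP existsP) => [[f /andP[/forallP lt_f /forallP iso_f]]|].
  exists (f (inord 0)), (f (inord 1)), (f (inord 2)).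
  have lt01 := forallP (lt_f (inord 0)) (inord 1).
  have lt12 := forallP (lt_f (inord 1)) (inord 2).
  have iso01 := forallP (iso_f (inord 0)) (inord 1).
  have iso12 := forallP (iso_f (inord 1)) (inord 2).
  move: lt01 lt12 iso01 iso12; rewrite !perm1 !inordK //=.
  by move=> -> -> /eqP -> /eqP ->.
case=> i [j [k [lt_ijk lt_pi]]].
exists [ffun x : 'I_3 => nth i [:: i; j; k] x].
apply/andP; split; apply/forallP=> -[[|[|[|x]]] ltx] //;
  apply/forallP=> -[[|[|[|y]]] lty] //; rewrite ?perm1 !ffunE /=; lia.
Qed.

Lemma contains_perm231P n (pi : 'S_n) :
  reflect (exists i j k : 'I_n, [/\ i < j < k & pi k < pi i < pi j])
          (contains pi perm231).
Proof.
apply: (iffP existsP) => [[f /andP[/forallP lt_f /forallP iso_f]]|].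
  exists (f (inord 0)), (f (inord 1)), (f (inord 2)).
  have lt01 := forallP (lt_f (inord 0)) (inord 1).
  have lt12 := forallP (lt_f (inord 1)) (inord 2).
  have iso01 := forallP (iso_f (inord 0)) (inord 1).
  have iso20 := forallP (iso_f (inord 2)) (inord 0).
  move: lt01 lt12 iso01 iso20; rewrite !permE /= !inordK //=.
  by move=> -> -> /eqP -> /eqP ->.
case=> i [j [k [lt_ijk lt_pi]]].
exists [ffun x : 'I_3 => nth i [:: i; j; k] x].
apply/andP; split; apply/forallP=> -[[|[|[|x]]] ltx] //;
  apply/forallP=> -[[|[|[|y]]] lty] //; rewrite ?permE !ffunE /=; lia.
Qed.

(** After an ascent pair, a value above the pair would create 123 and a value
    below it would create 231, hence all later values lie in between. *)
Definition confining n (pi : 'S_n) :=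
  forall i j k : 'I_n, i < j < k -> pi i < pi j -> pi i < pi k < pi j.

Lemma avoids_confining n (pi : 'S_n) :
  reflect (confining pi)
          (all (fun alpha : pattern => avoids pi (projT2 alpha)) T123_231).
Proof.
rewrite /= andbT /avoids.
apply: (iffP andP) => [[no123 no231] i j k ijk lt_pi|conf].
  have neq := @perm_val_neq _ pi.
  have [lt_ij lt_jk] := andP ijk.
  have := neq _ _ lt_jk; have := neq _ _ (ltn_trans lt_ij lt_jk).
  have : ~~ (pi i < pi j < pi k).
    by apply: contra no123 => ?; apply/contains_perm123P; exists i, j, k.
  have : ~~ (pi k < pi i < pi j).
    by apply: contra no231 => ?; apply/contains_perm231P; exists i, j, k.
  lia.
split; apply/negP.
- move=> /contains_perm123P[i [j [k [ijk lt_pi]]]].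
  by have := conf _ _ _ ijk; lia.
- move=> /contains_perm231P[i [j [k [ijk lt_pi]]]].
  by have := conf _ _ _ ijk; lia.
Qed.

Lemma block_confining n a b : a + b <= n -> confining (block_perm n a b).
Proof.
move=> le_ab_n i j k ijk; rewrite !block_permE //.
by have := ltn_ord k; rewrite /block; do ! case: ifP => ?; lia.
Qed.

(** For [b = 0] or [a + b = n] the permutation is the decreasing one whatever the
    other parameter; the pair [(0, 0)] is kept as its only representative. *)
Definition block_params n a b :=
  ((0 < b) && (a + b < n)) || ((a == 0) && (b == 0)).

(** By [perm_order_inj] it suffices to find the ascent pairs. Before the first
    position [j] that ends an ascent pair, the values decrease; those above the
    value at [j] form the first block and the others the second. Confinement
    extends the comparison with [j] to all later positions, and forces the values
    from [j] on to decrease. *)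
Lemma confining_block n (pi : 'S_n) : 0 < n -> confining pi ->
  exists2 x : 'I_n * 'I_n, block_params n x.1 x.2 & pi = block_perm n x.1 x.2.
Proof.
move=> n_gt0 conf.
suff [a [b [lt_ab_n ab_ok ascE]]]:
    exists a b, [/\ a + b < n, (0 < b) || (a == 0) &
      forall i k : 'I_n, i < k ->
        (pi i < pi k) = ((a <= i < a + b) && (a + b <= k))].
  have lt_a : a < n by lia.
  have lt_b : b < n by lia.
  exists (Ordinal lt_a, Ordinal lt_b); first by rewrite /block_params /=; lia.
  apply: perm_order_inj => i k lt_ik /=.
  have le_ab_n := ltnW lt_ab_n.
  by rewrite ascE // !block_permE // block_ascent // lt_ik ltn_ord.
have neq := @perm_val_neq _ pi.
pose tops (j : 'I_n) := [exists i : 'I_n, (i < j) && (pi i < pi j)].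
have [/existsP[j0 tops_j0]|no_asc] := boolP [exists j, tops j]; last first.
  exists 0, 0; split=> // i k lt_ik; have := neq i k lt_ik.
  move: no_asc; rewrite negb_exists => /forallP/(_ k).
  by rewrite negb_exists => /forallP/(_ i); lia.
(* j is the first position that is not a left-to-right minimum, and i is the
   first position whose value is smaller than the one at j. *)
case: (@arg_minnP _ j0 tops (fun j => j) tops_j0) => j /existsP[i0 asc_i0] min_j.
case: (@arg_minnP _ i0 (fun i : 'I_n => (i < j) && (pi i < pi j))
         (fun i => i) asc_i0) => i /andP[lt_ij asc_ij] min_i.
have decr (x y : 'I_n) : x < y < j -> pi y < pi x.
  move=> /andP[lt_xy lt_yj]; rewrite ltnNge leq_eqVlt negb_or neq //=.
  apply/negP => asc; have : j <= y; last lia.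
  by apply: min_j; apply/existsP; exists x; rewrite lt_xy.
exists i, (j - i); rewrite subnKC; last exact: ltnW.
split=> [||x y lt_xy]; rewrite ?ltn_ord ?subn_gt0 ?lt_ij //.
have [lt_yj|le_jy] := ltnP y j.
  by have := decr x y; lia.
have [le_jx|lt_xj] := leqP j x.
  have conf_j (z : 'I_n) : j < z -> pi i < pi z < pi j.
    by move=> lt_jz; apply: conf asc_ij; rewrite lt_ij.
  have [eq_xj|lt_jx] : x = j \/ j < x.
    by case: (ltngtP j x) le_jx => [? _|//|/val_inj -> _]; [right|left].
    by have := conf_j y; rewrite eq_xj in lt_xy *; lia.
  by have := conf_j x lt_jx; have := conf i x y; lia.
have le_asc : i <= x -> pi x < pi j.
  case: (ltngtP i x) => [lt_ix _|//|/val_inj <- _] //.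
  by have := decr i x; lia.
have ge_asc : x < i -> pi j < pi x.
  by have := min_i x; have := neq x j lt_xj; lia.
have [eq_yj|lt_jy] : y = j \/ j < y.
  by case: (ltngtP j y) le_jy => [? _|//|/val_inj -> _]; [right|left].
  by rewrite eq_yj; lia.
by have := conf i j y; have := conf x j y; lia.
Qed.

Lemma block_params_bound n a b : 0 < n -> block_params n a b -> a + b < n.
Proof. by rewrite /block_params; lia. Qed.

(** Unless the permutation is decreasing, the positions [a] and [a + b] are the
    first ones to begin and to end an ascent pair. *)
Lemma block_perm_inj n a b a' b' : 0 < n ->
    block_params n a b -> block_params n a' b' ->
  block_perm n a b = block_perm n a' b' -> a = a' /\ b = b'.
Proof.
move=> n_gt0 ok ok' eq_perm.
have [bnd bnd'] := (block_params_bound n_gt0 ok, block_params_bound n_gt0 ok').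
have asc i k : i < k < n ->
    ((a <= i < a + b) && (a + b <= k))
    = ((a' <= i < a' + b') && (a' + b' <= k)).
  move=> ikn; have lt_i : i < n by lia.
  have lt_k : k < n by lia.
  rewrite -(block_ascent (ltnW bnd) ikn) -(block_ascent (ltnW bnd') ikn).
  have pE j (lt_j : j < n) := block_permE (Ordinal lt_j) (ltnW bnd).
  have pE' j (lt_j : j < n) := block_permE (Ordinal lt_j) (ltnW bnd').
  by rewrite -(pE _ lt_i) -(pE _ lt_k) -(pE' _ lt_i) -(pE' _ lt_k) eq_perm.
have := asc a (a + b); have := asc a' (a' + b').
by move: ok ok'; rewrite /block_params; lia.
Qed.

Lemma s_count_sum n k : 0 < n ->
  s_count n k T123_231 =
  \sum_(a < n) \sum_(b < n) (block_params n a b && (block_fixed n a b == k)).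
Proof.
move=> n_gt0; pose bp (x : 'I_n * 'I_n) := block_perm n x.1 x.2.
pose A := [set x : 'I_n * 'I_n |
             block_params n x.1 x.2 && (block_fixed n x.1 x.2 == k)].
have fixE (x : 'I_n * 'I_n) : block_params n x.1 x.2 ->
    #|fixed_points (bp x)| = block_fixed n x.1 x.2.
  by move/(block_params_bound n_gt0)/ltnW; apply: card_fixed_block.
have -> : s_count n k T123_231 = #|A|.
  rewrite -(card_in_imset (f := bp)) => [|[a b] [a' b']]; last first.
    rewrite !inE => /andP[ok _] /andP[ok' _].
    by move/(block_perm_inj n_gt0 ok ok') => /= [/val_inj -> /val_inj ->].
  congr #|pred_of_set _|; apply/setP=> pi; rewrite inE; apply/andP/imsetP.
    case=> /eqP fix_k /avoids_confining/(confining_block n_gt0)[x ok eq_pi].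
    by exists x; rewrite // inE ok -fixE // /bp -eq_pi fix_k /=.
  case=> x; rewrite inE => /andP[ok /eqP fix_k] ->; rewrite fixE // fix_k eqxx.
  split=> //; apply/avoids_confining/block_confining.
  exact: ltnW (block_params_bound n_gt0 ok).
rewrite -sum1dep_card big_mkcond pair_big /=.
by apply: eq_bigr => x _; case: ifP.
Qed.

(** * Closed forms of the sums *)

Lemma sum_double_gap N h : h <= N -> (\sum_(a < N) (h - a)).*2 = h * h.+1.
Proof.
elim: N h => [|N IH] [|h] //; first by rewrite big_ord0.
  by rewrite big1 // => a _; rewrite sub0n.
move=> le_hN; rewrite big_ord_recl subn0 /=.
under eq_bigr => a _ do rewrite /bump /= add1n subSS.
by rewrite doubleD IH //; nia.
Qed.

Lemma double_sum_below N h : h <= N -> (\sum_(a < N) (a < h) * a).*2 = h * h.-1.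
Proof.
suff E M : (\sum_(a < M) (a < h) * a).*2 = minn h M * (minn h M).-1.
  by rewrite E => /minn_idPl ->.
elim: M => [|M IH]; first by rewrite big_ord0 minn0.
rewrite big_ord_recr doubleD IH /=.
case: (ltnP M h) => ?; last by rewrite !(minn_idPl _) //; nia.
by rewrite !(minn_idPr _) //; nia.
Qed.

Lemma high_fixed_value n : odd n ->
  (\sum_(a < n) (n < a.*2) * (n.-1 - a)).*2 = n./2 * n./2.-1.
Proof.
move=> odd_n; rewrite -(@double_sum_below n); last by lia.
congr (_.*2); rewrite (reindex_inj rev_ord_inj) /=; apply: eq_bigr => a _.
by have := ltn_ord a; case: (ltnP a n./2) => ?; case: ltnP; lia.
Qed.

(** Adding 2 to [a] and 6 to [n] preserves [n - 3 * a] and both parities, so the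
    passage from [n] to [n + 6] contributes one new term, at [a = odd n]. *)
Lemma sum_step6 N n :
  \sum_(a < N.+2) (odd a == odd (n + 6)) * (n + 6 - 3 * a)./2
  = (n + 6 - 3 * odd n)./2 + \sum_(a < N) (odd a == odd n) * (n - 3 * a)./2.
Proof.
rewrite 2!big_ord_recl addnA; congr (_ + _); first by rewrite /= /bump /=; lia.
apply: eq_bigr => a _; rewrite /= /bump /= !add1n; congr (_ * _); first by lia.
by congr (half _); lia.
Qed.

(** Twice the number of avoiders of length [6 * q + r] with two fixed points. *)
Definition two_fixed_value q r :=
  nth 0 [:: 3 * q * q.+1; q * (3 * q + 1); q.+1 * (3 * q + 2);
            3 * q * q.+1; q.+1 * (3 * q + 4); q.+1 * (3 * q + 2)] r.

Lemma double_two_fixed_sum N q r : r < 6 -> q.*2.+2 <= N ->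
  (\sum_(a < N) (odd a == odd (6 * q + r)) * (6 * q + r - 3 * a)./2).*2
  = two_fixed_value q r.
Proof.
move=> lt_r6; elim: q N => [|q IH] [|[|N]] // le_N.
  rewrite 2!big_ord_recl big1 => [|a _]; last first.
    by rewrite /= /bump /=; lia.
  by rewrite /= /bump /two_fixed_value; move: r lt_r6 => [|[|[|[|[|[|r]]]]]].
have -> : 6 * q.+1 + r = 6 * q + r + 6 by lia.
rewrite sum_step6 doubleD IH; last by lia.
rewrite /two_fixed_value.
by move: r lt_r6 {IH} => [|[|[|[|[|[|r]]]]]] //= _; nia.
Qed.

(** * Counting by number of fixed points *)

(** All parities involved follow from those of [n], [a] and [b], so eight cases
    with explicit halves leave only linear conditions. *)
Ltac parity_lia n a b :=
  rewrite /block_params /block_fixed ?oddD ?oddS;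
  have := odd_double_half n; have := odd_double_half a;
  have := odd_double_half b;
  case: (odd n); case: (odd a); case: (odd b);
  rewrite /= ?mul0n ?mul1n ?andbF ?andbT; lia.

(** A fixed point in the first block needs [n < 2 a], whereas the other two
    blocks need [2 a < n]. *)
Lemma block_fixed_le2 n a b : block_params n a b -> block_fixed n a b <= 2.
Proof. by rewrite /block_params /block_fixed; lia. Qed.

Lemma s_count_ge3 n k : 0 < n -> 3 <= k -> s_count n k T123_231 = 0.
Proof.
move=> n_gt0 k_ge3; rewrite s_count_sum // big1 // => a _; rewrite big1 // => b _.
by case ok: (block_params n a b) => //; have := block_fixed_le2 ok; lia.
Qed.

(** Two fixed points lie in the second and third blocks. For a given [a] this
    requires [a] and [n] to have the same parity, and [b] to run through the
    numbers of parity opposite to [a] with [a < b < n - 2 a]. *)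
Lemma s_count2 n : 0 < n ->
  s_count n 2 T123_231 = \sum_(a < n) (odd a == odd n) * (n - 3 * a)./2.
Proof.
move=> n_gt0; rewrite s_count_sum //; apply: eq_bigr => a _.
transitivity (\sum_(b < n) (odd a == odd n) *
   ((a.+1 <= b < n - a.*2) && (odd b == odd a.+1))).
  by apply: eq_bigr => b _; parity_lia n a b.
by rewrite -big_distrr sum_interval_parity /=; case: eqP => //; lia.
Qed.

Lemma sum_high_fixed n :
  \sum_(a < n) \sum_(b < n) (block_params n a b && (odd n && (n < a.*2)))
  = odd n * \sum_(a < n) (n < a.*2) * (n.-1 - a).
Proof.
rewrite big_distrr /=; apply: eq_bigr => a _.
transitivity (\sum_(b < n) (odd n && (n < a.*2)) * (1 <= b < n - a)).
  by apply: eq_bigr => b _; parity_lia n a b.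
by rewrite -big_distrr sum_interval -mulnb mulnA /=; congr (_ * _); lia.
Qed.

Lemma sum_low_fixed n :
  \sum_(a < n) \sum_(b < n) (block_params n a b && (odd (a + b) && (a < b)))
  = \sum_(a < n) (n./2 - a).
Proof.
apply: eq_bigr => a _.
transitivity (\sum_(b < n) ((a.+1 <= b < n - a) && (odd b == odd a.+1))).
  by apply: eq_bigr => b _; parity_lia n a b.
by rewrite sum_interval_parity; lia.
Qed.

(** The decreasing permutation of odd length, represented by [(0, 0)], has its
    central fixed point counted here; this is the summand [odd n]. *)
Lemma sum_last_fixed n : 0 < n ->
  \sum_(a < n) \sum_(b < n)
     (block_params n a b && (odd (n + b) && (a.*2 + b < n)))
  = odd n + \sum_(a < n) (n./2 - a).
Proof.
move=> n_gt0.
transitivity (\sum_(a < n) ((a == 0 :> nat) * odd n + (n./2 - a))).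
  apply: eq_bigr => a _.
  transitivity (\sum_(b < n) ((a == 0 :> nat) * odd n * (0 <= b < 1) +
      (((odd n).+1 <= b < n - a.*2) && (odd b == odd (odd n).+1)))).
    by apply: eq_bigr => b _; parity_lia n a b.
  by rewrite big_split -big_distrr sum_interval sum_interval_parity /=; lia.
rewrite big_split -big_distrl /=; congr (_ + _).
have -> : \sum_(a < n) (a == 0 :> nat) = \sum_(a < n) (0 <= a < 1 : nat).
  by apply: eq_bigr => a _; lia.
by rewrite sum_interval; lia.
Qed.

(** Counting pairs of an avoider and a fixed point of it, block by block. *)
Lemma s_count1 n : 0 < n ->
  s_count n 1 T123_231 + (s_count n 2 T123_231).*2 =
  odd n * \sum_(a < n) (n < a.*2) * (n.-1 - a) + odd n
  + (\sum_(a < n) (n./2 - a)).*2.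
Proof.
move=> n_gt0; rewrite -[in RHS]addnn -addnA [odd n + _]addnA.
rewrite -(sum_last_fixed n_gt0) -(sum_low_fixed n) -sum_high_fixed.
rewrite !s_count_sum // -addnn -!big_split.
apply: eq_bigr => a _; rewrite -!big_split; apply: eq_bigr => b _ /=.
have excl : block_params n a b ->
    ~~ ((n < a.*2) && (a < b)) && ~~ ((n < a.*2) && (a.*2 + b < n)).
  by rewrite /block_params; lia.
rewrite /block_fixed; case: (block_params n a b) excl => // /(_ isT).
by case: (n < a.*2); case: (a < b); case: (a.*2 + b < n);
  case: (odd n); case: (odd (a + b)); case: (odd (n + b)).
Qed.

Lemma s_count012 n : 0 < n ->
  s_count n 0 T123_231 + s_count n 1 T123_231 + s_count n 2 T123_231
  = 'C(n, 2).+1.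
Proof.
move=> n_gt0; rewrite !s_count_sum // -!big_split /=.
transitivity (\sum_(a < n) ((0 <= a < 1) + (n.-1 - a))); last first.
  rewrite big_split sum_interval.
  have := @sum_double_gap n n.-1; rewrite prednK // => /(_ (leq_pred n)) gaps.
  have := mul_bin_diag n 1; rewrite bin1 mulnC -gaps.
  by rewrite -muln2 /=; lia.
apply: eq_bigr => a _; rewrite -!big_split /=.
transitivity (\sum_(b < n) ((0 <= a < 1) * (0 <= b < 1) + (1 <= b < n - a))).
  apply: eq_bigr => b _; transitivity (block_params n a b : nat).
    case ok: (block_params n a b); last by [].
    by have := block_fixed_le2 ok; case: (block_fixed n a b) => [|[|[|]]].
  by rewrite /block_params; lia.
by rewrite big_split -big_distrr !sum_interval /=; lia.
Qed.

Import Order.TTheory GRing.Theory Num.Theory.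
Local Open Scope ring_scope.

(** * Rational closed forms *)

Lemma natr_bin2 m : 'C(m, 2)%:R = m%:R * (m%:R - 1) / 2 :> rat.
Proof.
have /(congr1 (fun k => k%:R : rat)) := mul_bin_diag m 1.
rewrite /= bin1 !natrM => binE.
have -> : 'C(m, 2)%:R = 2 * 'C(m, 2)%:R / 2 :> rat by field.
rewrite -binE; case: m {binE} => [|m] /=; first by rewrite !mul0r.
by rewrite -[m.+1]addn1 natrD addrK.
Qed.

Lemma s_count2_value n q r : (2 <= n)%N -> (r < 6)%N -> n = (6 * q + r)%N ->
  (s_count n 2 T123_231)%:R = (two_fixed_value q r)%:R / 2 :> rat.
Proof.
move=> n_ge2 r_lt6 nE; rewrite s_count2; last by lia.
rewrite -(@double_two_fixed_sum n) //; last by lia.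
by rewrite -nE -muln2 natrM; field.
Qed.

Lemma s_count1_value n : (2 <= n)%N -> let H : rat := n./2%:R in
  (s_count n 1 T123_231)%:R
  = (odd n)%:R * (H * (H - 1) / 2 + 1) + H * (H + 1)
    - 2 * (s_count n 2 T123_231)%:R :> rat.
Proof.
move=> n_ge2 H; have n_gt0 : (0 < n)%N by lia.
have HE : (n./2.-1)%:R = H - 1 by rewrite /H -subn1 natrB //; lia.
have /(congr1 (fun k => k%:R : rat)) := s_count1 n_gt0.
rewrite sum_double_gap; last by lia.
rewrite -muln2 !natrD !natrM -[(n./2.+1)]addn1 natrD -/H.
set S2 := (s_count n 2 _)%:R; set S1 := (s_count n 1 _)%:R.
case odd_n: (odd n); rewrite /= !(mulr0n, mulr1n); last by lra.
have /(congr1 (fun k => k%:R : rat)) := high_fixed_value odd_n.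
by rewrite -muln2 !natrM -/H HE; lra.
Qed.

Theorem theorem2p3 (n : nat) (hn : (2 <= n)%N) :
  let N : rat := n%:R in
  let s (k : nat) : rat := (s_count n k T123_231)%:R in
  [/\ forall k : nat, (3 <= k <= n)%N -> s_count n k T123_231 = 0%N,
      [/\ n = 0 %[mod 6] -> s 2%N = N * (N - 6) / 24 + N / 2,
          n = 1 %[mod 6] \/ n = 5 %[mod 6] -> s 2%N = (N - 1) * (N + 1) / 24,
          n = 2 %[mod 6] \/ n = 4 %[mod 6] ->
            s 2%N = (N - 4) * (N - 2) / 24 + N / 2
        & n = 3 %[mod 6] -> s 2%N = (N - 3) * (N + 3) / 24],
      (n = 0 %[mod 6] ->
         s 1%N = N * (N - 6) / 12 + 6 * 'C((n + 6) %/ 6, 2)%:R) /\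
      (n = 1 %[mod 6] ->
         s 1%N = (N - 3) * (N - 1) / 8 + (N - 7) * (N - 1) / 12
               + 6 * 'C((n + 5) %/ 6, 2)%:R + (N + 2) / 3) /\
      (n = 2 %[mod 6] ->
         s 1%N = N * (N - 2) / 12 + 6 * 'C((n + 4) %/ 6, 2)%:R) /\
      (n = 3 %[mod 6] ->
         s 1%N = (N - 3) * (N - 1) / 8 + (N - 5) * (N - 3) / 12
               + 6 * 'C((n + 3) %/ 6, 2)%:R + (2 * N + 3) / 3) /\
      (n = 4 %[mod 6] ->
         s 1%N = (N - 12) * (N + 2) / 12 + 6 * 'C((n + 8) %/ 6, 2)%:R) /\
      (n = 5 %[mod 6] ->
         s 1%N = (N - 3) * (N - 1) / 8 + (N - 5) * (N - 3) / 12
               + 6 * 'C((n + 1) %/ 6, 2)%:R + N)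
    & s 0%N = 'C(n, 2)%:R + 1 - s 1%N - s 2%N].
Proof.
move=> N s; have n_gt0 : (0 < n)%N by lia.
have nE : n = (6 * (n %/ 6) + n %% 6)%N by lia.
set q := (n %/ 6)%N in nE; pose Q : rat := q%:R.
have s2E r : (r < 6)%N -> (n %% 6 = r)%N -> s 2%N = (two_fixed_value q r)%:R / 2.
  by move=> r_lt6 rE; apply: s_count2_value; rewrite // -rE.
have s1E : s 1%N = _ := s_count1_value hn.
have NE r : (n %% 6 = r)%N -> N = 6 * Q + r%:R.
  by move=> rE; rewrite /N nE rE natrD natrM.
have oddE : odd n = odd (n %% 6) by lia.
have halfE r : (n %% 6 = r)%N -> (n./2)%:R = 3 * Q + (r./2)%:R :> rat.
  by move=> rE; rewrite -[3]/(3%:R) -natrM -natrD; congr (_%:R); lia.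
have castE := (natrM, natrD, mulr0n, mulr1n).
split.
- by move=> k /andP[k_ge3 _]; apply: s_count_ge3.
- split.
  + move=> /= rE; rewrite (s2E 0%N) // (NE 0%N) //.
    by rewrite /two_fixed_value /= -[q.+1]addn1 !castE -/Q; field.
  + case=> /= rE;
    [rewrite (s2E 1%N) // (NE 1%N) // | rewrite (s2E 5%N) // (NE 5%N) //];
    by rewrite /two_fixed_value /= -?[q.+1]addn1 !castE -/Q; field.
  + case=> /= rE;
    [rewrite (s2E 2%N) // (NE 2%N) // | rewrite (s2E 4%N) // (NE 4%N) //];
    by rewrite /two_fixed_value /= -?[q.+1]addn1 !castE -/Q; field.
  + move=> /= rE; rewrite (s2E 3%N) // (NE 3%N) //.
    by rewrite /two_fixed_value /= -[q.+1]addn1 !castE -/Q; field.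
- have binE m t : (m %/ 6 = q + t)%N ->
      'C(m %/ 6, 2)%:R = (Q + t%:R) * (Q + t%:R - 1) / 2 :> rat.
    by move=> ->; rewrite natr_bin2 natrD.
  have s1_solve r : (r < 6)%N -> (n %% 6 = r)%N ->
      s 1%N = (odd r)%:R * ((3 * Q + (r./2)%:R) * (3 * Q + (r./2)%:R - 1) / 2 + 1)
              + (3 * Q + (r./2)%:R) * (3 * Q + (r./2)%:R + 1)
              - (two_fixed_value q r)%:R.
    move=> r_lt6 rE; rewrite s1E oddE (halfE r) // -/(s 2%N) (s2E r) // rE.
    by field.
  split; [|split; [|split; [|split; [|split]]]] => /= rE.
  + rewrite (s1_solve 0%N) // (NE 0%N) // (binE _ 1%N); last by lia.
    by rewrite /two_fixed_value /= -addn1 !castE -/Q; field.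
  + rewrite (s1_solve 1%N) // (NE 1%N) // (binE _ 1%N); last by lia.
    by rewrite /two_fixed_value /= -?[q.+1]addn1 !castE -/Q; field.
  + rewrite (s1_solve 2%N) // (NE 2%N) // (binE _ 1%N); last by lia.
    by rewrite /two_fixed_value /= -[q.+1]addn1 !castE -/Q; field.
  + rewrite (s1_solve 3%N) // (NE 3%N) // (binE _ 1%N); last by lia.
    by rewrite /two_fixed_value /= -[q.+1]addn1 !castE -/Q; field.
  + rewrite (s1_solve 4%N) // (NE 4%N) // (binE _ 2%N); last by lia.
    by rewrite /two_fixed_value /= -[q.+1]addn1 !castE -/Q; field.
  + rewrite (s1_solve 5%N) // (NE 5%N) // (binE _ 1%N); last by lia.
    by rewrite /two_fixed_value /= -[q.+1]addn1 !castE -/Q; field.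
- have /(congr1 (fun k => k%:R : rat)) := s_count012 n_gt0.
  by rewrite -[_.+1]addn1 !natrD -/(s _) -/(s 1%N) -/(s 2%N); lra.
Qed.
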